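(* Any single-pass streaming algorithm that, on an $n$-vertex graph given as an insertion-only stream of edges, outputs a maximal independent set of the graph with probability at least $2/3$ requires $\Omega(n^2)$ bits of space.
   Context: A maximal independent set is an independent set not contained in any strictly larger independent set; the algorithm may output any such set. *)

(* Defs.v *)
From HB Require Import structures.
From mathcomp Require Import all_boot all_order all_algebra.
Set Implicit Arguments. Unset Strict Implicit. Unset Printing Implicit Defensive.
Import Order.TTheory GRing.Theory Num.Theory.

(* Vertices of an n-vertex graph are 'I_n.  An edge {u,v} is encoded by the
   ordered pair (u,v) with u < v.  An insertion-only edge stream of a simple
   graph is a duplicate-free sequence of such pairs; its graph is the set of
   streamed edges. *)
Definition edge n := ('I_n * 'I_n)%type.

Definition valid_stream n (st : seq (edge n)) : bool :=
  all (fun e : edge n => (e.1 < e.2)%N) st && uniq st.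

Definition adj n (st : seq (edge n)) (u v : 'I_n) : bool :=
  ((u, v) \in st) || ((v, u) \in st).

Definition independent n (st : seq (edge n)) (S : {set 'I_n}) : bool :=
  [forall u in S, forall v in S, ~~ adj st u v].

Definition maximal_independent n (st : seq (edge n)) (S : {set 'I_n}) : bool :=
  independent st S &&
  [forall T : {set 'I_n}, (independent st T && (S \subset T)) ==> (S == T)].

(* A randomized single-pass streaming algorithm on n-vertex graphs with
   s bits of memory.  Randomness: an arbitrary finite sample space with an
   arbitrary probability distribution (values in a real field F); the random
   string is read-only/public and is not charged to the space.  The memory
   state is a string of s bits. *)
Record stream_alg (F : realFieldType) (n s : nat) := StreamAlg {
  Rnd : finType;
  prob : Rnd -> F;
  init : Rnd -> {ffun 'I_s -> bool};
  step : Rnd -> {ffun 'I_s -> bool} -> edge n -> {ffun 'I_s -> bool};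
  output : Rnd -> {ffun 'I_s -> bool} -> {set 'I_n}
}.

Definition is_distribution (F : realFieldType) n s (A : stream_alg F n s) : Prop :=
  (forall r : Rnd A, 0 <= @prob F n s A r)%R /\ (\sum_(r : Rnd A) @prob F n s A r = 1)%R.

Definition run (F : realFieldType) n s (A : stream_alg F n s) (r : Rnd A)
  (st : seq (edge n)) : {ffun 'I_s -> bool} :=
  foldl (@step F n s A r) (@init F n s A r) st.

Definition success_prob (F : realFieldType) n s (A : stream_alg F n s)
  (st : seq (edge n)) : F :=
  (\sum_(r : Rnd A | maximal_independent st (@output F n s A r (@run F n s A r st))) @prob F n s A r)%R.

Definition solves_MIS (F : realFieldType) n s (A : stream_alg F n s) : Prop :=
  is_distribution A /\
  forall st : seq (edge n), valid_stream st -> (2%:R / 3%:R <= success_prob A st)%R.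

(* Main.v *)
(** The proof is a reduction from the INDEX communication problem.  Alice holds
    an [m * m] bit matrix [x], seen as a bipartite graph, and streams two
    disjoint copies of it.  Bob, who wants the bit [x (i, j)], joins every
    vertex of the first copy to every vertex of the second one, except for the
    special vertices [i] and [j] of both copies.  An independent set then misses
    all non-special vertices of one of the copies; in that copy, maximality
    forces both special vertices into the set as soon as they are not adjacent.
    So [x (i, j)] is the negation of "some copy has both special vertices in the
    output".

    For INDEX on [N] bits, fix the randomness so that the expected number of
    correctly decoded bits is at least [2 N / 3].  If [a x] is this number on
    input [x], then [\sum_x 2 ^ a x <= 2 ^ s * 3 ^ N], because a fixed memory
    state contributes at most [\sum_x 2 ^ agree = 3 ^ N], while by convexity
    [\sum_x 2 ^ a x >= 2 ^ N * 2 ^ (2 N / 3)].  Hence [s] is linear in [N]. *)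

Require Import Defs.
From HB Require Import structures.
From mathcomp Require Import all_boot all_order all_algebra.
From mathcomp Require Import zify ring lra.
Import Order.TTheory GRing.Theory Num.Theory.
Set Implicit Arguments.
Unset Strict Implicit.
Unset Printing Implicit Defensive.

(** * The INDEX problem *)

Definition agreement (I : finType) (x y : I -> bool) : nat :=
  \sum_(i : I) (y i == x i).

(** The sum factors over the coordinates, and each contributes [2 ^ 1 + 2 ^ 0 = 3]. *)
Lemma sum_exp2_agreement (I : finType) (y : I -> bool) :
  \sum_(x : {ffun I -> bool}) 2 ^ agreement x y = 3 ^ #|I|.
Proof.
transitivity (\prod_(i : I) \sum_(b : bool) 2 ^ (y i == b)).
  rewrite bigA_distr_bigA /=; apply: eq_bigr => x _.
  by rewrite /agreement expn_sum.
rewrite -[#|I|]/(#|xpredT : pred I|) -prod_nat_const; apply: eq_bigr => i _.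
by rewrite big_bool; case: (y i).
Qed.

(* The tangent line at [b] of the convex function [a |-> 2 ^ a], with the
   subtraction moved to the other side. *)
Lemma exp2_tangent a b : 2 ^ b * a.+1 <= 2 ^ a + 2 ^ b * b.
Proof.
have [le_ba|lt_ab] := leqP b a; last first.
  by rewrite (leq_trans _ (leq_addl _ _)) // leq_mul2l lt_ab orbT.
rewrite -(subnKC le_ba) expnD -mulnDr leq_mul2l; apply/orP; right.
by have := ltn_expl (a - b) (leqnn 2); lia.
Qed.

(** With [N = 3 * t] the mean [2 N / 3] is the integer [2 * t], and the two bounds become
    [2 ^ (5 t) = 32 ^ t] and [3 ^ (3 t) = 27 ^ t]. *)
Lemma index_deterministic (I S : finType) (t : nat)
    (enc : {ffun I -> bool} -> S) (dec : S -> I -> bool) :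
  #|I| = 3 * t ->
  2 * t * 2 ^ #|I| <= \sum_(x : {ffun I -> bool}) agreement x (dec (enc x)) ->
  32 ^ t <= #|S| * 27 ^ t.
Proof.
move=> cardI le_agree; set a := fun x : {ffun I -> bool} => agreement x (dec (enc x)).
have ub : \sum_x 2 ^ a x <= #|S| * 3 ^ #|I|.
  rewrite -[#|S|]/(#|xpredT : pred S|) -sum_nat_const.
  rewrite (partition_big enc xpredT) //=; apply: leq_sum => z _.
  (* For a fixed state [z], enlarge the sum from the inputs encoded as [z] to all inputs. *)
  rewrite -(sum_exp2_agreement (dec z)) [leqRHS](bigID (fun x => enc x == z)) /=.
  apply: leq_trans (leq_addr _ _); apply: leq_sum => x /eqP <-.
  exact: leqnn.
have card_x : #|{: {ffun I -> bool}}| = 2 ^ #|I| by rewrite card_ffun card_bool.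
(* Convexity: sum the tangent inequality taken at the mean [2 * t]. *)
have : \sum_(x : {ffun I -> bool}) 2 ^ (2 * t) * (a x).+1
     <= \sum_(x : {ffun I -> bool}) (2 ^ a x + 2 ^ (2 * t) * (2 * t)).
  by apply: leq_sum => x _; apply: exp2_tangent.
rewrite -big_distrr big_split /= sum_nat_const card_x.
under eq_bigr do rewrite -addn1.
rewrite big_split /= sum1_card card_x => tangent.
have lb : 2 ^ (2 * t) * 2 ^ #|I| <= \sum_x 2 ^ a x.
  move: le_agree tangent; rewrite -/a; set A := \sum_x a x; set B := \sum_x 2 ^ a x.
  move: (2 ^ (2 * t)) (2 ^ #|I|) => P Q leA; rewrite mulnDr => tangent.
  have : P * (2 * t * Q) <= P * A by rewrite leq_mul2l leA orbT.
  rewrite (_ : P * (2 * t * Q) = Q * (P * (2 * t))); last by ring.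
  lia.
have := leq_trans lb ub; rewrite cardI -expnD -mulnDl !expnM.
by [].
Qed.

(** Since [f] is integer-valued, [f < c] everywhere would force a mean of at most [c - 1]. *)
Lemma exists_ge_of_mean (F : realFieldType) (T : finType) (p : T -> F)
    (f : T -> nat) (c : nat) :
  (forall r, 0 <= p r)%R -> (\sum_r p r = 1)%R ->
  (c%:R - 1 < \sum_r p r * (f r)%:R)%R -> exists r, c <= f r.
Proof.
move=> p_ge0 p_sum1 mean; apply/existsP; apply: contraLR mean => /existsPn f_lt.
rewrite -leNgt; apply: (@le_trans _ _ (\sum_r p r * (c%:R - 1))%R); last first.
  by rewrite -mulr_suml p_sum1 mul1r.
apply: ler_sum => r _; apply: ler_wpM2l => //.
by rewrite lerBrDr natr1 ler_nat; have := f_lt r; rewrite -ltnNge.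
Qed.

Lemma index_randomized (F : realFieldType) (I S R : finType) (t : nat) (p : R -> F)
    (enc : R -> {ffun I -> bool} -> S) (dec : R -> S -> I -> bool) :
  #|I| = 3 * t ->
  (forall r, 0 <= p r)%R -> (\sum_r p r = 1)%R ->
  (forall x i, 2%:R / 3%:R <= \sum_(r | dec r (enc r x) i == x i) p r)%R ->
  32 ^ t <= #|S| * 27 ^ t.
Proof.
move=> cardI p_ge0 p_sum1 succ.
suff [r le_r] : exists r, 2 * t * 2 ^ #|I|
    <= \sum_(x : {ffun I -> bool}) agreement x (dec r (enc r x)).
  exact: index_deterministic le_r.
apply: (exists_ge_of_mean p_ge0 p_sum1); rewrite ltrBlDr.
apply: (@le_lt_trans _ _ (\sum_(r : R) p r *
    (\sum_(x : {ffun I -> bool}) agreement x (dec r (enc r x)))%:R)%R); last first.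
  by rewrite ltrDl.
have -> : (\sum_r p r * (\sum_(x : {ffun I -> bool})
              agreement x (dec r (enc r x)))%:R)%R
   = (\sum_(x : {ffun I -> bool}) \sum_i \sum_(r | dec r (enc r x) i == x i) p r)%R.
  under eq_bigr => r _.
    rewrite natr_sum mulr_sumr.
    under eq_bigr => x _ do rewrite /agreement natr_sum mulr_sumr.
    over.
  rewrite exchange_big; apply: eq_bigr => x _ /=.
  rewrite exchange_big; apply: eq_bigr => i _ /=.
  rewrite [RHS]big_mkcond; apply: eq_bigr => r _ /=.
  by case: eqP; rewrite ?mulr1 ?mulr0.
apply: (@le_trans _ _ (\sum_(x : {ffun I -> bool}) \sum_(i : I) (2%:R / 3%:R : F))%R).
  rewrite !sumr_const card_ffun card_bool cardI -mulrnA.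
  rewrite -[leRHS]mulr_natr !natrM; lra.
by do 2!apply: ler_sum => ? _; apply: succ.
Qed.

(** * Streaming a relation *)

Section GraphStream.

Variables (V : finType) (n : nat) (f : V -> 'I_n).
Hypothesis f_inj : injective f.

(** Filtering an enumeration makes the stream duplicate-free by construction; for symmetric [e], the
    order test keeps one orientation of each edge. *)
Definition rel_stream (e : rel V) : seq (edge n) :=
  [seq uv : edge n <- enum {: edge n} | (uv.1 < uv.2)
    && [exists a, exists b, [&& e a b, f a == uv.1 & f b == uv.2]]].

Lemma mem_rel_stream e u v : ((u, v) \in rel_stream e) = (u < v)
  && [exists a, exists b, [&& e a b, f a == u & f b == v]].
Proof. by rewrite mem_filter mem_enum andbT. Qed.

Lemma mem_rel_stream_image e a b :
  ((f a, f b) \in rel_stream e) = (f a < f b) && e a b.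
Proof.
rewrite mem_rel_stream; congr andb; apply/existsP/idP.
  by case=> a' /existsP[b' /and3P[eab /eqP/f_inj <- /eqP/f_inj <-]].
by move=> eab; exists a; apply/existsP; exists b; rewrite eab !eqxx.
Qed.

Variables e1 e2 : rel V.
Hypotheses (e1_sym : symmetric e1) (e2_sym : symmetric e2).
Hypotheses (e1_irr : irreflexive e1) (e2_irr : irreflexive e2).

Lemma valid_stream_cat_rel :
  (forall a b, e1 a b -> ~~ e2 a b) ->
  valid_stream (rel_stream e1 ++ rel_stream e2).
Proof.
move=> disj; rewrite /valid_stream all_cat cat_uniq.
have uniq_rel e : uniq (rel_stream e) by rewrite filter_uniq // enum_uniq.
rewrite !uniq_rel /= andbT; apply/andP; split.
  by apply/andP; split; apply/allP => uv; rewrite mem_filter => /andP[/andP[]].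
apply/hasPn => -[u v]; rewrite mem_rel_stream => /andP[_ /existsP[a /existsP[b]]].
case/and3P=> e2ab /eqP <- /eqP <- /=; rewrite mem_rel_stream_image negb_and.
by apply/orP; right; apply/negP => /disj; rewrite e2ab.
Qed.

Lemma adj_cat_rel a b :
  adj (rel_stream e1 ++ rel_stream e2) (f a) (f b) = e1 a b || e2 a b.
Proof.
rewrite /adj !mem_cat !mem_rel_stream_image (e1_sym b) (e2_sym b).
have [//|//|/val_inj/f_inj ->] := ltngtP (f a) (f b).
- by rewrite orbF.
- by rewrite e1_irr e2_irr.
Qed.

Lemma adj_cat_rel_codom u v :
  adj (rel_stream e1 ++ rel_stream e2) u v -> u \in codom f.
Proof.
rewrite /adj !mem_cat !mem_rel_stream => /orP[]/orP[]/andP[_].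
all: by case/existsP=> a /existsP[b /and3P[_ /eqP fa /eqP fb]]; rewrite -?fa -?fb codom_f.
Qed.

Lemma independent_cat_rel (S : {set 'I_n}) a b :
  independent (rel_stream e1 ++ rel_stream e2) S ->
  f a \in S -> f b \in S -> ~~ (e1 a b || e2 a b).
Proof.
move=> /forall_inP ind Sa Sb; rewrite -adj_cat_rel.
by move/forall_inP: (ind _ Sa); apply.
Qed.

(** Otherwise [f a] could be added to [S]. The neighbour found is in the image of [f] because all
    other vertices are isolated. *)
Lemma maximal_cat_rel (S : {set 'I_n}) a :
  maximal_independent (rel_stream e1 ++ rel_stream e2) S ->
  f a \notin S -> exists2 b, f b \in S & e1 a b || e2 a b.
Proof.
set st := _ ++ _ => /andP[ind /forallP max] Sa.
have [/existsP[v /andP[Sv av]]|/existsPn noadj] :=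
    boolP [exists v, (v \in S) && adj st (f a) v].
  have adjC u w : adj st u w = adj st w u by rewrite /adj orbC.
  have /codomP[b vE] : v \in codom f by move: av; rewrite adjC; apply: adj_cat_rel_codom.
  by exists b; rewrite -?vE // -adj_cat_rel -vE.
have noadjS v : v \in S -> ~~ adj st (f a) v.
  by move=> Sv; have := noadj v; rewrite Sv.
have /implyP := max (f a |: S); rewrite subsetUr andbT => maxa.
suff indT : independent st (f a |: S).
  by move: Sa; rewrite (eqP (maxa indT)) setU11.
apply/forall_inP => u /setU1P[->|Su]; apply/forall_inP => v /setU1P[->|Sv].
- by rewrite adj_cat_rel e1_irr e2_irr.
- exact: noadjS.
- by rewrite /adj orbC; apply: noadjS.
- by move/forall_inP: ind => /(_ u Su)/forall_inP; apply.
Qed.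

End GraphStream.

(** * The reduction *)

Section Reduction.

Variable m : nat.

(* [(c, d, k)] is the [k]-th vertex on side [d] of copy [c]; row vertices have
   [d = false] and column vertices [d = true]. *)
Definition vertex := (bool * bool * 'I_m)%type.

Implicit Types (x : {ffun 'I_m * 'I_m -> bool}) (ij : 'I_m * 'I_m) (a b : vertex).

Definition matrix_rel x a b : bool :=
  [&& a.1.1 == b.1.1, a.1.2 != b.1.2 &
      x (if a.1.2 then (b.2, a.2) else (a.2, b.2))].

Definition special ij a : bool := a.2 == if a.1.2 then ij.2 else ij.1.

Definition query_rel ij a b : bool :=
  [&& a.1.1 != b.1.1, ~~ special ij a & ~~ special ij b].

Lemma matrix_rel_sym x : symmetric (matrix_rel x).
Proof. by move=> [[[] []] k] [[[] []] l]. Qed.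

Lemma matrix_rel_irr x : irreflexive (matrix_rel x).
Proof. by move=> a; rewrite /matrix_rel !eqxx. Qed.

Lemma query_rel_sym ij : symmetric (query_rel ij).
Proof. by move=> a b; rewrite /query_rel eq_sym [X in _ && X]andbC. Qed.

Lemma query_rel_irr ij : irreflexive (query_rel ij).
Proof. by move=> a; rewrite /query_rel eqxx. Qed.

Lemma matrix_query_disjoint x ij a b : matrix_rel x a b -> ~~ query_rel ij a b.
Proof. by case/and3P=> cab _ _; rewrite /query_rel cab. Qed.

Variables (n : nat) (f : vertex -> 'I_n).
Hypothesis f_inj : injective f.

Definition decode ij (S : {set 'I_n}) : bool :=
  ~~ [exists c : bool, (f (c, false, ij.1) \in S) && (f (c, true, ij.2) \in S)].

Lemma decode_maximal x ij (S : {set 'I_n}) :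
  maximal_independent (rel_stream f (matrix_rel x) ++ rel_stream f (query_rel ij)) S ->
  decode ij S = x ij.
Proof.
move=> mis; have /andP[ind _] := mis.
have indS := independent_cat_rel f_inj (@matrix_rel_sym x) (@query_rel_sym ij)
  (@matrix_rel_irr x) (@query_rel_irr ij) ind.
have maxS := maximal_cat_rel f_inj (@matrix_rel_sym x) (@query_rel_sym ij)
  (@matrix_rel_irr x) (@query_rel_irr ij) mis.
case: ij indS maxS {mis ind} => i j indS maxS; rewrite /decode /=.
have [xij|xij] := boolP (x (i, j)).
  apply/existsPn => c; apply/negP => /andP[Si Sj].
  by have := indS _ _ Si Sj; rewrite /matrix_rel /= eqxx xij.
apply/negbF/existsP.
(* Non-special vertices of [S] in both copies would be joined by a query edge. *)
have [c missed] : exists c, forall a, a.1.1 = c -> f a \in S -> special (i, j) a.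
  pose hit c := [exists a, [&& a.1.1 == c, f a \in S & ~~ special (i, j) a]].
  have miss c : ~~ hit c -> forall a, a.1.1 = c -> f a \in S -> special (i, j) a.
    by move=> /existsPn nh a ac Sa; have := nh a; rewrite ac eqxx Sa negbK.
  have [hF|/miss] := boolP (hit false); last by exists false.
  have [hT|/miss] := boolP (hit true); last by exists true.
  have [a /and3P[/eqP ac Sa na]] := existsP hF.
  have [b /and3P[/eqP bc Sb nb]] := existsP hT.
  by have := indS _ _ Sa Sb; rewrite /query_rel ac bc na nb orbT.
(* A special vertex outside [S] would have a neighbour in [S]. Query edges avoid special vertices,
   so it lies on the other side of copy [c]; by [missed] it is the other special vertex, and the
   edge would require [x (i, j)]. *)
have inS d : f (c, d, if d then j else i) \in S.
  apply: contraT => /maxS[[[c' d'] l] Sb /orP[]]; last first.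
    by rewrite /query_rel /special /=; case: d; rewrite eqxx andbF.
  case/and3P=> /= /eqP cc' dd' xl; have /= := missed (c', d', l) (esym cc') Sb.
  rewrite /special /= => /eqP lE; move: xl; rewrite {}lE.
  by case: d d' dd' {Sb} => [] [] //= _; rewrite (negPf xij).
by exists c; rewrite (inS false) (inS true).
Qed.

End Reduction.

(** * The quadratic space bound *)

Lemma MIS_space_exp (F : realFieldType) (n s k : nat) (A : stream_alg F n s) :
  12 * k <= n -> solves_MIS A -> 32 ^ (3 * k ^ 2) <= 2 ^ s * 27 ^ (3 * k ^ 2).
Proof.
(* A multiple of 3 makes [m ^ 2 = 3 * (3 * k ^ 2)] fit the INDEX bound; the two copies use
   [4 * m = 12 * k] vertices. *)
move=> le_kn [[p_ge0 p_sum1] succ]; pose m := 3 * k.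
have card_le : #|{: vertex m}| <= n.
  by rewrite !card_prod !card_bool card_ord /m; lia.
pose f (a : vertex m) := widen_ord card_le (enum_rank a).
have f_inj : injective f by move=> a b /(congr1 val) /= /val_inj /enum_rank_inj.
have -> : 2 ^ s = #|{: {ffun 'I_s -> bool}}| by rewrite card_ffun card_bool card_ord.
(* Alice's message is the memory state after the matrix edges; Bob resumes the run from it. *)
pose enc (r : Rnd A) x := run r (rel_stream f (matrix_rel x)).
pose dec (r : Rnd A) z ij := decode f ij
  (output r (foldl (step r) z (rel_stream f (query_rel ij)))).
apply: (@index_randomized F ('I_m * 'I_m)%type _ _ _ (@prob F n s A) enc dec) => //.
  by rewrite card_prod !card_ord /m; lia.
move=> x ij; pose st := rel_stream f (matrix_rel x) ++ rel_stream f (query_rel ij).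
have st_valid : valid_stream st.
  by apply: valid_stream_cat_rel => // a b; apply: matrix_query_disjoint.
apply: (le_trans (succ _ st_valid)); rewrite /success_prob.
rewrite [leLHS]big_mkcond [leRHS]big_mkcond; apply: ler_sum => r _ /=.
case: ifP => [mis|_]; last by case: ifP.
suff -> : dec r (enc r x) ij == x ij by [].
by move: mis; rewrite /dec /enc /run foldl_cat => /(decode_maximal f_inj) ->.
Qed.

(** Raising the second hypothesis to the power [t] and the third to the power [e] gives [2 ^ t * b ^
    (t e) <= a ^ (t e) <= 2 ^ (s e) * b ^ (t e)]. *)
Lemma exponent_bound a b e s t :
  0 < b -> 2 * b ^ e <= a ^ e -> a ^ t <= 2 ^ s * b ^ t -> t <= s * e.
Proof.
move=> b_gt0 le_ab; case: t => // t le_t.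
rewrite -(leq_exp2l t.+1 (s * e) (ltnSn 1)).
rewrite -(leq_pmul2r (_ : 0 < b ^ (t.+1 * e))) ?expn_gt0 ?b_gt0 //.
apply: (@leq_trans (a ^ (t.+1 * e))).
  by rewrite ![t.+1 * e]mulnC !expnM -expnMn leq_exp2r.
case: e {le_ab} => [|e]; first by rewrite !muln0.
by rewrite !expnM -expnMn leq_exp2r.
Qed.

Lemma MIS_space (F : realFieldType) (n s k : nat) (A : stream_alg F n s) :
  12 * k <= n -> solves_MIS A -> 3 * k ^ 2 <= s * 5.
Proof.
(* 5 is the least exponent [e] with [(32 / 27) ^ e >= 2]. *)
move=> le_kn solA; have le_base : 2 * 27 ^ 5 <= 32 ^ 5 by lia.
exact: exponent_bound (ltn0Sn 26) le_base (MIS_space_exp le_kn solA).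
Qed.

(* Omega(n^2): there are c > 0 and n0 such that for all n >= n0, every
   algorithm solving MIS on n-vertex graphs with s bits uses s >= c * n^2. *)
Theorem mainTheorem9 :
  exists (c : rat) (n0 : nat), (0 < c)%R /\
    forall (F : realFieldType) (n s : nat) (A : stream_alg F n s),
      (n0 <= n)%N -> solves_MIS A -> (c * (n ^ 2)%:R <= s%:R :> rat)%R.
Proof.
(* With [k = n %/ 12 >= 1], [n <= 24 * k], so [n ^ 2 <= 576 * k ^ 2 = 192 * (3 * k ^ 2) <= 960 *
   s]. *)
exists (960%:R^-1)%R, 12; split; first by rewrite invr_gt0.
move=> F n s A le12n solA.
have c_gt0 : (0 < 960%:R :> rat)%R by rewrite ltr0n.
rewrite (ler_pdivrMl _ _ c_gt0) -natrM ler_nat.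
have le_kn : 12 * (n %/ 12) <= n by lia.
have := MIS_space le_kn solA.
have : n <= 24 * (n %/ 12) by lia.
move: (n %/ 12) => k; nia.
Qed.
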